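(* Consider a CSP $\phi := \langle x \cdot y = z \ ;\ x \in D_x, y \in D_y, z \in D_z\rangle$, where $D_x, D_y, D_z$ are non-empty integer intervals such that $$0 \in \langle D_x \rangle \cap \langle D_y \rangle \ \text{ implies } \ 0 \in D_z .$$ Suppose that $\phi$ is closed under the applications of the MULTIPLICATION 1, MULTIPLICATION 2 and MULTIPLICATION 3 rules. Then $\phi$ is bounds consistent.
   Context: An integer interval is a set $[l..h] = \{x \in \mathbb{Z} \mid l \le x \le h\}$ with $l,h$ integers; $[l,h]$ denotes the corresponding real interval. For an integer interval $D := [l..h]$ put $\langle D \rangle := \{x \in \mathbb{Z} \mid l < x < h\}$. The constraint satisfaction problem (CSP) $\langle x \cdot y = z \ ;\ x \in D_x, y \in D_y, z \in D_z\rangle$ consists of the variables $x,y,z$ with respective domains $D_x, D_y, D_z$ and the single constraint $x \cdot y = z$. Bounds consistency: the CSP $\langle x \cdot y = z \ ;\ x \in [l_x..h_x], y \in [l_y..h_y], z \in [l_z..h_z]\rangle$ is bounds consistent if - $\forall a \in \{l_x,h_x\}\ \exists b \in [l_y,h_y]\ \exists c \in [l_z,h_z]\ a \cdot b = c$, - $\forall b \in \{l_y,h_y\}\ \exists a \in [l_x,h_x]\ \exists c \in [l_z,h_z]\ a \cdot b = c$, - $\forall c \in \{l_z,h_z\}\ \exists a \in [l_x,h_x]\ \exists b \in [l_y,h_y]\ a \cdot b = c$, where the existential quantifiers range over real intervals. For sets of integers $X, Y$: $X \cdot Y := \{x \cdot y \mid x \in X, y \in Y\}$ and $X/Y := \{u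 \in \mathbb{Z} \mid \exists x \in X\ \exists y \in Y\ u \cdot y = x\}$. For a set of integers $X$, $\operatorname{int}(X)$ is the smallest integer interval containing $X$ if $X$ is finite, and $\mathbb{Z}$ otherwise. The rules transform the CSP $\langle x \cdot y = z \ ;\ x \in D_x, y \in D_y, z \in D_z\rangle$ as follows: - MULTIPLICATION 1 replaces $D_z$ by $D_z \cap \operatorname{int}(D_x \cdot D_y)$; - MULTIPLICATION 2 replaces $D_x$ by $D_x \cap \operatorname{int}(D_z / D_y)$; - MULTIPLICATION 3 replaces $D_y$ by $D_y \cap \operatorname{int}(D_z / D_x)$. A CSP is closed under the applications of a rule if applying the rule leaves all domains unchanged. *)

(* Defs.v *)
From HB Require Import structures.
From mathcomp Require Import all_boot all_order all_algebra.
From mathcomp Require Import mathcomp_extra boolp classical_sets functions.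
From mathcomp Require Import cardinality set_interval reals.

Set Implicit Arguments.
Unset Strict Implicit.
Unset Printing Implicit Defensive.

Import Order.TTheory GRing.Theory Num.Theory.

Local Open Scope classical_set_scope.
Local Open Scope ring_scope.

(* Empty when h < l. *)
Definition int_itv (l h : int) : set int := `[l, h].

Definition int_itv_inner (l h : int) : set int := `]l, h[.

Definition real_itv (R : realType) (l h : int) : set R := `[l%:~R, h%:~R].

Definition is_int_itv (D : set int) : Prop := exists l h : int, D = int_itv l h.

Definition set_mul (X Y : set int) : set int := [set x * y | x in X & y in Y].

(* Not the pointwise image of a division: y = 0 contributes every u as soon as
   0 belongs to X, and nothing otherwise. *)
Definition set_div (X Y : set int) : set int :=
  [set u | exists2 x, X x & exists2 y, Y y & u * y = x].

Definition int_hull (X : set int) : set int :=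
  if `[< finite_set X >] then smallest is_int_itv X else setT.

(* [smallest] is an intersection; for finite X it is itself an integer interval
   (empty if X is), hence really the least one containing X. *)
Lemma int_hull_is_int_itv (X : set int) :
  finite_set X -> is_int_itv (int_hull X) /\ X `<=` int_hull X.
Proof.
move=> fX; rewrite /int_hull asboolT //; split; last exact: sub_smallest.
have [s Xs] : exists s : seq int, X = [set` s] by exact/finite_seqP.
case: s Xs => [|x s] Xs.
  exists 1, 0; apply/seteqP; split; last by move=> u; rewrite /int_itv /= itv_ge.
  apply: smallest_sub; first by exists 1, 0.
  by rewrite Xs => u.
have [m [M [Xm XM mM]]] : exists m M : int,
    [/\ m \in x :: s, M \in x :: s & forall u, u \in x :: s -> m <= u <= M].
  elim: s x {Xs} => [|y s IHs] x.
    by exists x, x; split=> [||u]; rewrite inE // => /eqP ->; rewrite lexx.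
  have [m [M [ym yM mM]]] := IHs y.
  exists (Num.min x m), (Num.max x M); split.
  - by rewrite minEle; case: ifP => _; rewrite inE ?eqxx // ym orbT.
  - by rewrite maxEle; case: ifP => _; rewrite inE ?eqxx // yM orbT.
  - move=> u; rewrite in_cons => /orP[/eqP ->|/mM/andP[mu uM]].
      by rewrite ge_min le_max lexx.
    by rewrite ge_min le_max mu uM !orbT.
exists m, M; apply/seteqP; split.
  apply: smallest_sub; first by exists m, M.
  by rewrite Xs => u /= /mM; rewrite /int_itv /= in_itv.
move=> u; rewrite /int_itv /= in_itv /= => /andP[mu uM] _ [[l [h ->]] XD].
have := XD m; have := XD M; rewrite Xs /int_itv /= !in_itv /=.
move=> /(_ XM)/andP[_ Mh] /(_ Xm)/andP[lm _].
by rewrite (le_trans lm mu) (le_trans uM Mh).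
Qed.

(* The CSP with the single constraint x * y = z, given by its domains. *)
Record mul_csp := MulCSP {
  dom_x : set int;
  dom_y : set int;
  dom_z : set int
}.

Definition itv_csp (lx hx ly hy lz hz : int) : mul_csp :=
  MulCSP (int_itv lx hx) (int_itv ly hy) (int_itv lz hz).

Definition multiplication1 (phi : mul_csp) : mul_csp :=
  let: MulCSP Dx Dy Dz := phi in
  MulCSP Dx Dy (Dz `&` int_hull (set_mul Dx Dy)).

Definition multiplication2 (phi : mul_csp) : mul_csp :=
  let: MulCSP Dx Dy Dz := phi in
  MulCSP (Dx `&` int_hull (set_div Dz Dy)) Dy Dz.

Definition multiplication3 (phi : mul_csp) : mul_csp :=
  let: MulCSP Dx Dy Dz := phi in
  MulCSP Dx (Dy `&` int_hull (set_div Dz Dx)) Dz.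

Definition closed_under (rule : mul_csp -> mul_csp) (phi : mul_csp) : Prop :=
  rule phi = phi.

(* Bounds consistency of [itv_csp lx hx ly hy lz hz]; the witnesses are real. *)
Definition bounds_consistent (R : realType) (lx hx ly hy lz hz : int) : Prop :=
  [/\ forall a : R, [set lx%:~R; hx%:~R] a ->
        exists2 b : R, real_itv ly hy b &
        exists2 c : R, real_itv lz hz c & a * b = c,
      forall b : R, [set ly%:~R; hy%:~R] b ->
        exists2 a : R, real_itv lx hx a &
        exists2 c : R, real_itv lz hz c & a * b = c
    & forall c : R, [set lz%:~R; hz%:~R] c ->
        exists2 a : R, real_itv lx hx a &
        exists2 b : R, real_itv ly hy b & a * b = c].

(* Main.v *)
(** A point of the hull of a bounded set lies between two points of that set.
A bound c of Dz thus satisfies x1 * y1 <= c <= x2 * y2, and x * y = c is solved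
by moving one factor at a time.  A bound a of Dx satisfies u1 <= a <= u2 with
u1 * y1 = z1 and u2 * y2 = z2.  If y1 and y2 have the same sign, a * y - z
changes sign along the segment from (y1, z1) to (y2, z2).  Otherwise 0 is
interior to Dy; then either 0 is in Dz and (0, 0) is a solution, or Dx and Dz
have constant signs, so that Dz / Dx has constant sign and its hull cannot
contain both bounds of Dy. *)
Require Import Defs.
From mathcomp Require Import all_boot all_order all_algebra.
From mathcomp Require Import classical_sets reals.
From mathcomp Require Import boolp cardinality.
From mathcomp Require Import zify ring lra.

Set Implicit Arguments.
Unset Strict Implicit.
Unset Printing Implicit Defensive.

Import Order.TTheory GRing.Theory Num.Theory.

Local Open Scope classical_set_scope.
Local Open Scope ring_scope.

Lemma int_itvE (l h u : int) : int_itv l h u <-> l <= u <= h.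
Proof. by rewrite /int_itv /= in_itv. Qed.

Lemma real_itvE (R : realType) (l h : int) (u : R) :
  real_itv l h u <-> l%:~R <= u <= h%:~R.
Proof. by rewrite /real_itv /= in_itv. Qed.

Lemma finite_int_itv (l h : int) : finite_set (int_itv l h).
Proof.
apply: (@sub_finite_set _ _ [set l + n%:Z | n in `I_(`|h - l|.+1)%N]).
  move=> u /int_itvE luh; exists `|u - l|%N => /=; lia.
exact/finite_image/finite_II.
Qed.

Lemma int_hull_sub (X : set int) (l h : int) :
  X `<=` int_itv l h -> int_hull X `<=` int_itv l h.
Proof.
move=> Xlh; rewrite /int_hull asboolT; last first.
  exact: sub_finite_set Xlh (finite_int_itv l h).
by apply: smallest_sub => //; exists l, h.
Qed.

(** The bound [M] makes [X] finite, so its hull is not all of the integers. If [X] had no point on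
    one side of [a], it would fit in an interval that stops just short of [a], and so would its
    hull. *)
Lemma int_hull_between (X : set int) (M a : int) :
  (forall u, X u -> `|u| <= M) -> int_hull X a ->
  exists u1 u2, [/\ X u1, X u2 & u1 <= a <= u2].
Proof.
move=> XM Xa.
have [u1 Xu1 u1a] : exists2 u, X u & u <= a.
  apply: contrapT => noX.
  have /int_hull_sub/(_ _ Xa)/int_itvE : X `<=` int_itv (a + 1) M.
    move=> u Xu; apply/int_itvE; have := XM _ Xu.
    have : ~ (u <= a) by move=> ua; apply: noX; exists u.
    lia.
  lia.
have [u2 Xu2 au2] : exists2 u, X u & a <= u.
  apply: contrapT => noX.
  have /int_hull_sub/(_ _ Xa)/int_itvE : X `<=` int_itv (- M) (a - 1).
    move=> u Xu; apply/int_itvE; have := XM _ Xu.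
    have : ~ (a <= u) by move=> au; apply: noX; exists u.
    lia.
  lia.
by exists u1, u2; split=> //; rewrite u1a.
Qed.

Lemma set_mul_hull_between (lx hx ly hy c : int) :
  int_hull (set_mul (int_itv lx hx) (int_itv ly hy)) c ->
  exists x1 y1 x2 y2,
    [/\ lx <= x1 <= hx, ly <= y1 <= hy, lx <= x2 <= hx, ly <= y2 <= hy
      & x1 * y1 <= c <= x2 * y2].
Proof.
case/(@int_hull_between _ ((`|lx| + `|hx|) * (`|ly| + `|hy|))).
  move=> _ [x /int_itvE xP [y /int_itvE yP <-]].
  by rewrite normrM; apply: ler_pM => //; lia.
move=> c1 [c2 [[x1 /int_itvE ? [y1 /int_itvE ? e1]]]].
move=> [x2 /int_itvE ? [y2 /int_itvE ? e2]] ?.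
by exists x1, y1, x2, y2; rewrite e1 e2.
Qed.

(* Without the side condition Z / Y is all of the integers. *)
Lemma set_div_hull_between (lz hz ly hy a : int) :
  ~ (int_itv ly hy 0 /\ int_itv lz hz 0) ->
  int_hull (set_div (int_itv lz hz) (int_itv ly hy)) a ->
  exists u1 y1 u2 y2,
    [/\ lz <= u1 * y1 <= hz, ly <= y1 <= hy, lz <= u2 * y2 <= hz,
        ly <= y2 <= hy & u1 <= a <= u2].
Proof.
move=> nz; case/(@int_hull_between _ (`|lz| + `|hz|)).
  move=> u [z zP [y yP uyz]].
  have [y0|y0] := eqVneq y 0.
    by case: nz; split; [rewrite -y0|move: zP; rewrite -uyz y0 mulr0].
  (* A nonzero integer divisor has absolute value at least 1, so the quotient is no larger than
     [z]. *)
  move/int_itvE: zP => zP; suff : `|u| <= `|z| by lia.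
  rewrite -uyz normrM ler_peMr //; lia.
move=> u1 [u2 [[z1 /int_itvE z1P [y1 /int_itvE ? e1]]]].
move=> [z2 /int_itvE z2P [y2 /int_itvE ? e2]] ?.
by exists u1, y1, u2, y2; rewrite e1 e2.
Qed.

Lemma intr_itv (R : numDomainType) (l h u : int) :
  l <= u <= h -> l%:~R <= (u%:~R : R) <= h%:~R.
Proof. by rewrite !ler_int. Qed.

(** The affine map sending (y, z) to [a * y - z] is nonnegative at ([y1], [z1]) and nonpositive at
    ([y2], [z2]), so it vanishes on the segment between them, which stays in the box by
    convexity. *)
Lemma mulr_segment_solution (R : realFieldType)
    (a ly hy lz hz y1 y2 z1 z2 : R) :
  ly <= y1 <= hy -> ly <= y2 <= hy -> lz <= z1 <= hz -> lz <= z2 <= hz ->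
  z1 <= a * y1 -> a * y2 <= z2 ->
  exists2 b, ly <= b <= hy & lz <= a * b <= hz.
Proof.
move=> y1P y2P z1P z2P f1 f2.
have [f10|f10] := eqVneq (a * y1) z1; first by exists y1; rewrite ?f10.
have d_gt0 : 0 < (a * y1 - z1) + (z2 - a * y2).
  by rewrite ltr_pwDl ?subr_ge0 // subr_gt0 lt_neqAle eq_sym f10.
set d := _ + _ in d_gt0.
(* Barycentric weights of the zero, by linear interpolation; [d] is the total drop along the
   segment. *)
pose s := (z2 - a * y2) / d; pose t := (a * y1 - z1) / d.
have s_ge0 : 0 <= s by rewrite divr_ge0 ?subr_ge0 // ltW.
have t_ge0 : 0 <= t by rewrite divr_ge0 ?subr_ge0 // ltW.
have st1 : s = 1 - t.
  by rewrite /s /t /d; field; rewrite -/d; lra.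
have conv (l h p q : R) : l <= p <= h -> l <= q <= h -> l <= s * p + t * q <= h.
  by move=> /andP[? ?] /andP[? ?]; apply/andP; split; nra.
exists (s * y1 + t * y2); first exact: conv.
suff -> : a * (s * y1 + t * y2) = s * z1 + t * z2 by exact: conv.
by rewrite /s /t /d; field; rewrite -/d; lra.
Qed.

Lemma mul_hull_support (R : realType) (lx hx ly hy c : int) :
  int_hull (set_mul (int_itv lx hx) (int_itv ly hy)) c ->
  exists2 a : R, real_itv lx hx a &
  exists2 b : R, real_itv ly hy b & a * b = c%:~R.
Proof.
case/set_mul_hull_between => x1 [y1 [x2 [y2 [x1P y1P x2P y2P /andP[c1 c2]]]]].
have cc : c <= c <= c by rewrite lexx.
(* Go from ([x1], [y1]) to ([x2], [y2]) through the corner ([x1], [y2]): the product at the corner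
   decides which leg crosses [c]. The degenerate interval from [c] to [c] turns membership into
   equality. *)
have [cm|mc] := leP c (x1 * y2).
  have [||b bP abc] := mulr_segment_solution (intr_itv R y2P)
      (intr_itv R y1P) (intr_itv R cc) (intr_itv R cc) (a := x1%:~R); rewrite -?intrM ?ler_int //.
  exists x1%:~R; first exact/real_itvE/intr_itv.
  by exists b; [exact/real_itvE|apply/esym/le_anti].
have [||a aP bac] := mulr_segment_solution (intr_itv R x2P)
    (intr_itv R x1P) (intr_itv R cc) (intr_itv R cc) (a := y2%:~R);
  rewrite -?intrM ?ler_int // 1?mulrC // 1?ltW //.
exists a; first exact/real_itvE.
exists y2%:~R; first exact/real_itvE/intr_itv.
by rewrite mulrC; apply/esym/le_anti.
Qed.

Lemma div_hull_support (R : realType) (lx hx ly hy lz hz a : int) :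
  ((int_itv_inner lx hx `&` int_itv_inner ly hy) 0 -> int_itv lz hz 0) ->
  int_itv lx hx `<=` int_hull (set_div (int_itv lz hz) (int_itv ly hy)) ->
  int_itv ly hy `<=` int_hull (set_div (int_itv lz hz) (int_itv lx hx)) ->
  int_itv lx hx a ->
  exists2 b : R, real_itv ly hy b &
  exists2 c : R, real_itv lz hz c & a%:~R * b = c.
Proof.
move=> inner0 subx suby Dxa.
suff [b bP abP] : exists2 b : R, ly%:~R <= b <= hy%:~R
    & lz%:~R <= a%:~R * b <= hz%:~R.
  exists b; first exact/real_itvE.
  by exists (a%:~R * b) => //; exact/real_itvE.
have [[/int_itvE y0 /int_itvE z0]|nyz] :=
    pselect (int_itv ly hy 0 /\ int_itv lz hz 0).
  by exists 0%:~R; rewrite ?mulr0; exact: (@intr_itv R _ _ 0).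
have [u1 [y1 [u2 [y2 [z1P y1P z2P y2P /andP[u1a au2]]]]]] :=
  set_div_hull_between nyz (subx _ Dxa).
have not_inner : ~ (ly < 0 < hy).
  move=> lyh.
  have nxz : ~ (int_itv lx hx 0 /\ int_itv lz hz 0).
    by move=> [_ z0]; apply: nyz; split=> //; apply/int_itvE; lia.
  have lyP : int_itv ly hy ly by apply/int_itvE; lia.
  have hyP : int_itv ly hy hy by apply/int_itvE; lia.
  have [v1 [x1 [? [? [w1P x1P _ _ v1l]]]]] := set_div_hull_between nxz (suby _ lyP).
  have [? [? [v2 [x2 [_ _ w2P x2P v2h]]]]] := set_div_hull_between nxz (suby _ hyP).
  have z0 : ~ (lz <= 0 <= hz).
    by move=> z0; apply: nyz; split; apply/int_itvE; lia.
  have x0 : ~ (lx < 0 < hx).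
    move=> x0; apply: z0; apply/int_itvE/inner0.
    by rewrite /int_itv_inner; split; rewrite /= in_itv.
  (* By [x0], [x1] and [x2] lie on the same side of 0, while [v1 <= ly < 0 < hy <= v2]. Hence 0 lies
     between [v1 * x1] and [v2 * x2], both in Dz, against [z0]. *)
  have [x1lt|x1gt|x1eq] := ltgtP x1 0; [| |by apply: z0; rewrite x1eq mulr0 in w1P].
    have x2le : x2 <= 0 by lia.
    by apply: z0; nia.
  have x2ge : 0 <= x2 by lia.
  by apply: z0; nia.
have y0 (u y : int) : lz <= u * y <= hz -> ly <= y <= hy -> y <> 0.
  move=> zP yP yE; apply: nyz; rewrite yE ?mulr0 in zP yP.
  by split; apply/int_itvE.
have := y0 _ _ z1P y1P; have := y0 _ _ z2P y2P => y2n0 y1n0.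
(* Multiplying [u1 <= a <= u2] by negative [y1] and [y2] reverses the inequalities, so the endpoints
   of the segment are then exchanged. Opposite signs would put 0 strictly inside Dy. *)
have [y1gt|y1le] := ltP 0 y1; have [y2gt|y2le] := ltP 0 y2.
- apply: (mulr_segment_solution (intr_itv R y1P) (intr_itv R y2P)
    (intr_itv R z1P) (intr_itv R z2P)); rewrite -intrM ler_int; nia.
- by case: not_inner; lia.
- by case: not_inner; lia.
- apply: (mulr_segment_solution (intr_itv R y2P) (intr_itv R y1P)
    (intr_itv R z2P) (intr_itv R z1P)); rewrite -intrM ler_int; nia.
Qed.

Theorem theorem9p3 (R : realType) (lx hx ly hy lz hz : int)
  (Dx_neq0 : int_itv lx hx !=set0)
  (Dy_neq0 : int_itv ly hy !=set0)
  (Dz_neq0 : int_itv lz hz !=set0)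
  (zero_in_Dz : (int_itv_inner lx hx `&` int_itv_inner ly hy) 0 ->
                int_itv lz hz 0)
  (closed1 : closed_under multiplication1 (itv_csp lx hx ly hy lz hz))
  (closed2 : closed_under multiplication2 (itv_csp lx hx ly hy lz hz))
  (closed3 : closed_under multiplication3 (itv_csp lx hx ly hy lz hz)) :
  bounds_consistent R lx hx ly hy lz hz.
Proof.
have subx : int_itv lx hx `<=` int_hull (set_div (int_itv lz hz) (int_itv ly hy)).
  by apply/setIidPl; case: closed2.
have suby : int_itv ly hy `<=` int_hull (set_div (int_itv lz hz) (int_itv lx hx)).
  by apply/setIidPl; case: closed3.
have subz : int_itv lz hz `<=` int_hull (set_mul (int_itv lx hx) (int_itv ly hy)).
  by apply/setIidPl; case: closed1.
have ends (l h : int) : int_itv l h !=set0 -> int_itv l h l /\ int_itv l h h.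
  by case=> u /int_itvE /andP[lu uh]; split; apply/int_itvE;
    rewrite lexx (le_trans lu uh).
have [[lxP hxP] [lyP hyP] [lzP hzP]] :=
  And3 (ends _ _ Dx_neq0) (ends _ _ Dy_neq0) (ends _ _ Dz_neq0).
split.
- by move=> _ [->|->]; apply: div_hull_support subx suby _.
(* The bounds of Dy follow by exchanging the roles of x and y. *)
- have zero_in_Dz' : (int_itv_inner ly hy `&` int_itv_inner lx hx) 0 ->
      int_itv lz hz 0 by rewrite setIC.
  move=> b bP.
  have [a aP [c cP bac]] : exists2 a : R, real_itv lx hx a &
      exists2 c : R, real_itv lz hz c & b * a = c.
    by case: bP => ->; apply: div_hull_support suby subx _.
  by exists a => //; exists c; rewrite // mulrC.
- by move=> _ [->|->]; apply: mul_hull_support; apply: subz.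
Qed.
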